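(* There exist absolute constants $c,c_1,c_2,\epsilon_0>0$ such that for every $\epsilon\in(0,\epsilon_0)$ the following holds: if a (possibly randomized) allocator for the Memory Reallocation problem with load factor $1-\epsilon$ guarantees, for every $M\in\mathbb{Z}^+$ and every update sequence fixed in advance with load factor $1-\epsilon$ in which all object sizes lie in $[c_1\epsilon^{3/7}M,\ c_2\epsilon^{3/7}M]$, that each update's squared overhead factor has expectation at most $g(\epsilon)$, then $g(\epsilon)\ge c\,\epsilon^{-1/7}$.
   Context: Memory Reallocation problem: the memory consists of $M$ slots indexed $0,\dots,M-1$; there is a dynamically changing set $X$ of live objects with sizes $\mu(x)\in\mathbb{Z}^+$. An allocation is a map $\phi\colon X\to\{0,\dots,M-1\}$ with $\phi(x)+\mu(x)\le M$ and the intervals $[\phi(x),\phi(x)+\mu(x))$ pairwise disjoint. Starting from $X=\varnothing$, updates (insert a new object of given size, or delete a live object) arrive online; after each update the allocator outputs an allocation of the new set $X'$, possibly moving existing objects. If the update inserts/deletes $x$ and the allocation changes from $\phi$ to $\phi'$, the overhead factor is $1+\frac{1}{\mu(x)}\sum_{y\in X\cap X',\ \phi(y)\ne\phi'(y)}\mu(y)$, and the squared overhead is its square. An update sequence has load factor $1-\epsilon$ if at all times $\sum_{x\in X}\mu(x)\le(1-\epsilon)M$. Expectations are over the allocator's randomness, with the update sequence fixed in advance (oblivious adversary). *)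

(* Defs.v *)
From HB Require Import structures.
From mathcomp Require Import all_boot all_order all_algebra.
From mathcomp Require Import finmap.
From mathcomp Require Import all_classical all_reals all_analysis.

Set Implicit Arguments.
Unset Strict Implicit.
Unset Printing Implicit Defensive.

Import Order.TTheory GRing.Theory Num.Theory.
Local Open Scope ring_scope.

(* An object is a pair (name, size); the name only serves to tell apart
   distinct objects of equal size. *)
Definition object := (nat * nat)%type.
Definition mu (x : object) : nat := x.2.

Variant update := Insert of object | Delete of object.

Definition updated (u : update) : object :=
  match u with Insert x => x | Delete x => x end.

Definition step (X : {fset object}) (u : update) : {fset object} :=
  match u with Insert x => (x |` X)%fset | Delete x => (X `\ x)%fset end.

(* Update sequences are listed in chronological order. *)
Definition live (s : seq update) : {fset object} := foldl step fset0 s.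

Definition legal (h : seq update) (u : update) : Prop :=
  match u with
  | Insert x => (0 < mu x)%N /\ x \notin map updated h
  | Delete x => x \in live h
  end.

Definition update_sequence (s : seq update) : Prop :=
  forall h u r, s = h ++ u :: r -> legal h u.

Definition has_load_factor (R : realType) (M : nat) (lambda : R)
    (s : seq update) : Prop :=
  forall h r, s = h ++ r -> \sum_(x <- live h) (mu x)%:R <= lambda * M%:R.

Definition sizes_within (R : realType) (a b : R) (s : seq update) : Prop :=
  forall x, x \in map updated s -> a <= (mu x)%:R <= b.

Definition occupies (phi : object -> nat) (x : object) (i : nat) : Prop :=
  (phi x <= i < phi x + mu x)%N.

(* Only the values of phi on X are meaningful. *)
Definition is_allocation (M : nat) (X : {fset object}) (phi : object -> nat) :
    Prop :=
  (forall x, x \in X -> (phi x < M)%N /\ (phi x + mu x <= M)%N) /\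
  (forall x y, x \in X -> y \in X -> x <> y ->
     forall i, ~ (occupies phi x i /\ occupies phi y i)).

(* [A M s w] is the allocation of [live s] output in a memory with M slots right
   after the updates s, when the random outcome is w: it depends on the updates
   received so far, and not on later ones. *)
Definition strategy (T : Type) := nat -> seq update -> T -> object -> nat.

Definition is_allocator (R : realType) (lambda : R)
    (d : measure_display) (T : measurableType d) (A : strategy T) : Prop :=
  forall M s, (0 < M)%N -> update_sequence s -> has_load_factor M lambda s ->
    (forall w, is_allocation M (live s) (A M s w)) /\
    (forall x k, x \in live s -> measurable [set w | A M s w x = k]%classic).

Definition overhead (R : realType) (T : Type) (A : strategy T) (M : nat)
    (h : seq update) (u : update) (w : T) : R :=
  let phi := A M h w in
  let phi' := A M (rcons h u) w in
  1 + (mu (updated u))%:R^-1 *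
      \sum_(y <- (live h `&` live (rcons h u))%fset | phi y != phi' y) (mu y)%:R.

(* Main.v *)
Require Import Defs.
From HB Require Import structures.
From mathcomp Require Import all_boot all_order all_algebra.
From mathcomp Require Import finmap zify ring lra.
From mathcomp Require Import all_classical all_reals all_analysis.
From mathcomp Require Import measurable_realfun.

(* Take n objects of sizes 2(n+1) + 2v with v <= n, whose excesses v sum to n,
   in a memory with a single free slot. The address of an object then
   determines its rank i and the sum P(i) of the excesses of the objects below
   it. Start from n objects of excess 1, where P(i) = i, and repeatedly replace
   two objects of excesses p and q by objects of excesses p + q and 0,
   following a binary heap, until one object carries all the excess, where P(i)
   is 0 or n. This forces a total variation of P of order n^2. A replacement
   that moves k objects changes P at O(k) ranks, by O(k) times the largest
   excess alive, which is O(n/i) when heap node i is created; so the sum over i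
   of (n/i) k_i^2 is of order at least n^2. Taking expectations, the squared
   overhead is at least of order n / log n for some update; a cruder bound on
   the harmonic sum gives n^(1/3), which is enough for n of order eps^(-3/7). *)

Set Implicit Arguments.
Unset Strict Implicit.
Unset Printing Implicit Defensive.

Import Order.TTheory GRing.Theory Num.Theory.

(** * Packing of intervals *)

Lemma allocation_disjoint M X phi x y : is_allocation M X phi ->
  x \in X -> y \in X -> phi x < phi y -> 0 < mu y -> phi x + mu x <= phi y.
Proof.
move=> [_ disj] xX yX ltxy muy; case: (leqP (phi x + mu x) (phi y)) => // lt.
case: (disj x y xX yX _ (phi y)) => [exy|]; first by rewrite exy ltnn in ltxy.
by split; rewrite /occupies; lia.
Qed.

Lemma allocation_inj M X phi x y : is_allocation M X phi ->
  x \in X -> y \in X -> 0 < mu x -> 0 < mu y -> phi x = phi y -> x = y.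
Proof.
move=> [_ disj] xX yX mx my e; apply: contrapT => nxy.
by apply: (disj x y xX yX nxy (phi x)); split; rewrite /occupies; lia.
Qed.

(** The slots occupied by the objects of [s] form a duplicate-free list inside [iota lo (hi - lo)],
    so counting slots gives the bound. *)
Lemma packing M X phi lo hi (s : seq object) : is_allocation M X phi ->
  uniq s -> {subset s <= X} ->
  (forall x, x \in s -> lo <= phi x /\ phi x + mu x <= hi) ->
  \sum_(x <- s) mu x <= hi - lo.
Proof.
move=> [_ disj] us sX bnd; set f := fun x => iota (phi x) (mu x).
have uf : uniq (flatten (map f s)).
  elim: s us sX {bnd} => //= x s IH /andP[xs us] sX.
  have IHs : uniq (flatten (map f s)).
    by apply: IH => // y ys; apply: sX; rewrite inE ys orbT.
  rewrite cat_uniq iota_uniq IHs andbT /=.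
  apply/hasPn => i /flattenP[l /mapP[y ys ->]]; rewrite /f !mem_iota => iy.
  apply/negP => ix; apply: (disj x y _ _ _ i) => //.
  - by apply: sX; rewrite inE eqxx.
  - by apply: sX; rewrite inE ys orbT.
  - by move=> exy; rewrite exy ys in xs.
have sub : {subset flatten (map f s) <= iota lo (hi - lo)}.
  move=> i /flattenP[l /mapP[y ys ->]]; rewrite /f !mem_iota.
  by have := bnd y ys; lia.
have := uniq_leq_size uf sub.
rewrite size_iota size_flatten /shape sumnE !big_map.
by under eq_bigr => x _ do rewrite size_iota.
Qed.

(** * Tight states and their profiles *)

Definition excess (n : nat) (x : object) : nat := (mu x)./2 - n.+1.

(** Memory is cut into blocks of the least object size. In a tight state every block below [n]
    contains exactly one start address ([tight_cells]), so the cell of an object is its rank. *)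
Definition cell (n : nat) (phi : object -> nat) (x : object) : nat :=
  phi x %/ (n.+1).*2.

Definition profile (n : nat) (X : {fset object}) (phi : object -> nat)
    (i : nat) : nat :=
  \sum_(x <- X | cell n phi x < i) excess n x.

(** The [n] base sizes [2(n+1)] and the total excess [n], counted twice, fill [2n(n+2)] slots; one
    more slot is left free. *)
Definition memory (n : nat) : nat := (n * n.+2).*2.+1.

Record tight (n : nat) (X : {fset object}) : Prop := Tight {
  tight_card : #|` X| = n;
  tight_total : \sum_(x <- X) mu x = (n * n.+2).*2;
  tight_size : forall x, x \in X -> mu x = (n.+1 + excess n x).*2 }.

Lemma sum_tight n X (p : pred object) : tight n X ->
  \sum_(x <- X | p x) mu x =
    count p X * (n.+1).*2 + (\sum_(x <- X | p x) excess n x).*2.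
Proof.
move=> tX; rewrite -sum1_count big_distrl /= -[X in _ + X]muln2 big_distrl /=
  -big_split /=.
rewrite big_seq_cond [RHS]big_seq_cond; apply: eq_bigr => x /andP[xX _].
by rewrite [LHS](tight_size tX xX); lia.
Qed.

Lemma tight_excess n X : tight n X -> \sum_(x <- X) excess n x = n.
Proof.
move=> tX; have := sum_tight xpredT tX.
by rewrite (tight_total tX) count_predT (_ : size X = n) ?(tight_card tX) //;
  nia.
Qed.

Lemma tight_mu_gt0 n X x : tight n X -> x \in X -> 0 < mu x.
Proof. by move=> tX xX; rewrite (tight_size tX xX); lia. Qed.

(* At a tight state at most one slot is free, while sizes are even and excesses
   sum to n: the address of x then encodes the number of objects before it and
   the sum of their excesses. *)
Lemma tight_address n X phi x : tight n X -> is_allocation (memory n) X phi ->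
  x \in X ->
  cell n phi x = count (fun y => cell n phi y < cell n phi x) X /\
  profile n X phi (cell n phi x) = (phi x %% (n.+1).*2)./2.
Proof.
move=> tX al xX.
have ltE y : y \in X -> (cell n phi y < cell n phi x) = (phi y < phi x).
  move=> yX; apply/idP/idP => [|lt].
    by apply: contraTT; rewrite -!leqNgt; apply: leq_div2r.
  have := allocation_disjoint al yX xX lt (tight_mu_gt0 tX xX).
  rewrite (tight_size tX yX) => le.
  rewrite /cell; apply: (@leq_trans ((phi y + (n.+1).*2) %/ (n.+1).*2)).
    by rewrite divnDr // divnn; lia.
  by apply: leq_div2r; lia.
set p := fun y => phi y < phi x.
have cE : count (fun y => cell n phi y < cell n phi x) X = count p X.
  by apply: eq_in_count => y yX; rewrite ltE.
have pE : profile n X phi (cell n phi x) = \sum_(y <- X | p y) excess n y.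
  by rewrite /profile big_seq_cond [RHS]big_seq_cond; apply: eq_bigl => y /=;
    case: (boolP (y \in X)) => //= yX; rewrite ltE.
have uX : uniq X by apply: fset_uniq.
(* The objects below [x] fit before [phi x] and the others after it; with a single free slot,
   [phi x] is the total size below [x], or one more. *)
have leB : \sum_(y <- X | p y) mu y <= phi x.
  rewrite -big_filter -[leqRHS]subn0.
  apply: (packing al); first exact: filter_uniq.
    by move=> y; rewrite mem_filter => /andP[].
  move=> y; rewrite mem_filter => /andP[py yX]; split => //.
  exact: allocation_disjoint al yX xX py (tight_mu_gt0 tX xX).
have leC : \sum_(y <- X | ~~ p y) mu y <= memory n - phi x.
  rewrite -big_filter; apply: (packing al); first exact: filter_uniq.
    by move=> y; rewrite mem_filter => /andP[].
  move=> y; rewrite mem_filter /p -leqNgt => /andP[py yX]; split => //.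
  by have [] := al.1 y yX.
have tot : \sum_(y <- X | p y) mu y + \sum_(y <- X | ~~ p y) mu y =
  (n * n.+2).*2.
  by rewrite -(tight_total tX) [RHS](bigID p).
have lex : phi x < memory n by have [] := al.1 x xX.
have exc : \sum_(y <- X | p y) excess n y <= n.
  by rewrite -{2}(tight_excess tX) [leqRHS](bigID p) leq_addr.
have sB := sum_tight p tX.
rewrite cE pE /cell; move: tot leB leC exc sB lex.
set S := \sum_(y <- X | p y) mu y; set S' := \sum_(y <- X | ~~ p y) mu y.
set E := \sum_(y <- X | p y) _; set b := count p X.
move: S S' E b => S S' E b tot leB leC exc sB lex.
have pos : phi x = b * (n.+1).*2 + (phi x - b * (n.+1).*2) by lia.
have bnd : E.*2 <= phi x - b * (n.+1).*2 <= E.*2.+1.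
  by rewrite /memory in leC lex; lia.
(* As [E <= n], the offset is at most [2n+1]: it does not spill into the next cell, and halving it
   discards the free slot. *)
have lta : phi x - b * (n.+1).*2 < (n.+1).*2 by lia.
split; first by rewrite pos divnMDl // divn_small // addn0.
by rewrite pos modnMDl modn_small //; lia.
Qed.

(** Sizes are at least the cell length, so cells are distinct. By [tight_address] a cell index
    counts objects other than its own, hence is below [n]; [n] distinct values below [n] exhaust
    [iota 0 n]. *)
Lemma tight_cells n X phi : tight n X -> is_allocation (memory n) X phi ->
  perm_eq (map (cell n phi) X) (iota 0 n).
Proof.
move=> tX al.
have inj : {in X &, injective (cell n phi)}.
  move=> x y xX yX e.
  have [mx my] := (tight_mu_gt0 tX xX, tight_mu_gt0 tX yX).
  apply: (allocation_inj al) => //.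
  wlog ltxy : x y xX yX e mx my / phi x < phi y.
    move=> H; case: (ltngtP (phi x) (phi y)) => // lt; first exact: H.
    by symmetry; apply: H.
  have := allocation_disjoint al xX yX ltxy my;
    rewrite (tight_size tX xX) => le.
  have : (phi x + (n.+1).*2) %/ (n.+1).*2 <= phi y %/ (n.+1).*2.
    by apply: leq_div2r; lia.
  by rewrite divnDr // divnn -/(cell n phi x) -/(cell n phi y) e; lia.
have u : uniq (map (cell n phi) X) by rewrite map_inj_in_uniq // fset_uniq.
have sz : size (map (cell n phi) X) =
  n by rewrite size_map -[RHS](tight_card tX).
apply: uniq_perm => //; first exact: iota_uniq.
have sub : {subset map (cell n phi) X <= iota 0 n}.
  move=> i /mapP[x xX ->]; rewrite mem_iota /= add0n.
  have [-> _] := tight_address tX al xX.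
  set p := fun y => _; have szX : size X = n := tight_card tX.
  have := count_predC p X; rewrite szX.
  suff : 0 < count (predC p) X by lia.
  by rewrite -has_count; apply/hasP; exists x; rewrite // /p /= ltnn.
have := uniq_min_size u sub; rewrite size_iota sz => /(_ (leqnn _))[_].
by move=> e i; rewrite e.
Qed.

Lemma sum_cells n X phi (F : nat -> nat) :
  tight n X -> is_allocation (memory n) X phi ->
  \sum_(0 <= i < n) F i = \sum_(x <- X) F (cell n phi x).
Proof.
move=> tX al; rewrite /index_iota subn0.
by rewrite -(perm_big _ (tight_cells tX al)) big_map.
Qed.

(** The absolute difference: with truncated subtraction one of the summands is 0. *)
Definition adist (a b : nat) : nat := (a - b) + (b - a).

Lemma leq_adist_trans b a c : adist a c <= adist a b + adist b c.
Proof. by rewrite /adist; lia. Qed.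

Lemma profile_start n X phi i : tight n X -> is_allocation (memory n) X phi ->
  (forall x, x \in X -> excess n x = 1) -> i <= n -> profile n X phi i = i.
Proof.
move=> tX al e1 le_in.
transitivity (\sum_(x <- X) (cell n phi x < i : nat)).
  rewrite /profile big_mkcond /=; apply: eq_big_seq => x xX.
  by rewrite e1 //; case: ifP.
rewrite -(sum_cells (fun j => (j < i : nat)) tX al).
rewrite (@big_cat_nat _ _ _ i) //= [X in _ + X]big_nat_cond [X in _ +
  X]big1 ?addn0.
  rewrite (eq_big_nat _ _ (F2 := fun=> 1)) ?sum_nat_const_nat ?subn0 ?muln1 //.
  by move=> j /andP[_ ->].
by move=> j /andP[/andP[le _] _]; rewrite ltnNge le.
Qed.

(** By [tight_excess] the whole excess [n] sits on [x0], which is either counted at [i] or not. *)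
Lemma profile_end n X phi i x0 : tight n X ->
  (forall x, x \in X -> x != x0 -> excess n x = 0) ->
  profile n X phi i = 0 \/ profile n X phi i = n.
Proof.
move=> tX e0.
have exc := tight_excess tX.
have key (p : pred object) : \sum_(x <- X | p x) excess n x =
    (x0 \in X) * p x0 * excess n x0.
  case: (boolP (x0 \in X)) => [x0X|x0X].
    rewrite big_mkcond (big_fsetD1 x0) //= big_seq big1 ?addn0 ?mul1n.
      by case: (p x0); rewrite ?mul1n.
    by move=> x; rewrite !inE => /andP[nx xX]; rewrite e0 ?if_same.
  rewrite !mul0n big_seq_cond big1 // => x /andP[xX _]; apply: e0 => //.
  by apply: contraNneq x0X => <-.
rewrite (key xpredT) in exc; rewrite /profile key.
by case: (_ < _); [right|left]; lia.
Qed.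

Definition kept (X X' : {fset object}) (phi phi' : object ->
  nat) : {fset object} :=
  [fset x in X | (x \in X') && (phi x == phi' x)]%fset.

Lemma mem_kept X X' phi phi' x :
  (x \in kept X X' phi phi') = [&& x \in X, x \in X' & phi x == phi' x].
Proof. by rewrite !inE. Qed.

(* An object that stays in place also keeps its cell and the profile there, so
   the profile changes only at the cells of the other objects, and there only by
   the excesses of those objects. *)
Lemma profile_change n X X' phi phi' w :
  tight n X -> tight n X' ->
  is_allocation (memory n) X phi -> is_allocation (memory n) X' phi' ->
  (forall x, x \in X -> excess n x <= w) ->
  (forall x, x \in X' -> excess n x <= w) ->
  \sum_(0 <= i < n) adist (profile n X phi i) (profile n X' phi' i) <=
    (n - #|` kept X X' phi phi'|) ^ 2 * w.
Proof.
move=> tX tX' al al' leX leX'; set U := kept X X' phi phi'.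
have UX : {subset U <= X} by move=> x; rewrite mem_kept => /and3P[].
have UX' : {subset U <= X'} by move=> x; rewrite mem_kept => /and3P[].
have cellU x : x \in U -> cell n phi x = cell n phi' x.
  by rewrite mem_kept /cell => /and3P[_ _ /eqP->].
have profU x : x \in U ->
  profile n X phi (cell n phi' x) = profile n X' phi' (cell n phi' x).
  move=> xU; rewrite -{1}cellU //.
  rewrite (tight_address tX al (UX _ xU)).2 (tight_address tX' al' (UX' _
    xU)).2.
  by move: xU; rewrite mem_kept => /and3P[_ _ /eqP->].
have cardD (Y : {fset object}) : {subset U <= Y} -> tight n Y ->
    count (fun x => x \notin U) Y = n - #|` U|.
  move=> UY tY; rewrite -(tight_card tY).
  have := count_predC (mem U) Y; rewrite -[size Y]/(#|` Y|).
  have -> : count (mem U) Y = #|` U|; last by rewrite -/(predC _) => <-;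
    rewrite addKn; apply: eq_count.
  rewrite -size_filter; apply/perm_size/uniq_perm;
    rewrite ?filter_uniq ?fset_uniq //.
  by move=> x; rewrite mem_filter; rewrite inE;
    case: (boolP (x \in U)) => //= xU; rewrite UY.
have leD (Y : {fset object}) p : {subset U <= Y} -> tight n Y ->
    (forall x, x \in Y -> excess n x <= w) ->
    \sum_(x <- Y | p x && (x \notin U)) excess n x <= (n - #|` U|) * w.
  move=> UY tY leY; rewrite -(cardD Y) // -sum1_count big_distrl /=.
  rewrite big_mkcondl big_seq_cond [leqRHS]big_seq_cond.
  apply: leq_sum => x /andP[xY _]; rewrite mul1n; case: (p x) => //; exact: leY.
have splitD (Y : {fset object}) p : {subset U <= Y} ->
    \sum_(x <- Y | p x) excess n x =
    \sum_(x <- U | p x) excess n x +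
      \sum_(x <- Y | p x && (x \notin U)) excess n x.
  move=> UY; rewrite (bigID (mem U)) /=; congr (_ + _).
  rewrite -big_filter -[RHS]big_filter; apply/perm_big/uniq_perm;
    rewrite ?filter_uniq ?fset_uniq //.
  move=> x; rewrite !mem_filter; case: (boolP (x \in U)) => [xU|] /=;
    last by rewrite !andbF.
  by rewrite UY // !andbT.
(* The kept objects contribute equally to both profiles. What remains on either side lies between 0
   and [(n - #|U|) * w], and so does the difference. *)
have change i : adist (profile n X phi i) (profile n X' phi' i) <=
  (n - #|` U|) * w.
  rewrite /profile (splitD X) // (splitD X') //.
  have -> : \sum_(x <- U | cell n phi x < i) excess n x =
    \sum_(x <- U | cell n phi' x < i) excess n x.
    rewrite big_seq_cond [RHS]big_seq_cond; apply: eq_bigl => x.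
    by case: (boolP (x \in U)) => //= xU; rewrite cellU.
  have := leD X (fun x => cell n phi x < i) UX tX leX.
  have := leD X' (fun x => cell n phi' x < i) UX' tX' leX'.
  by rewrite /adist; lia.
(* Indexing the ranks by the objects of [X'], the kept ones contribute 0 and [n - #|U|] terms
   remain. *)
rewrite (sum_cells _ tX' al') (bigID (mem U)) /= big_seq_cond big1.
  rewrite add0n -(cardD X') // expnSr expn1 -mulnA -sum1_count big_distrl /=.
  by apply: leq_sum => x _; rewrite mul1n sum1_count cardD.
by move=> x /andP[_ xU]; rewrite profU // /adist subnn.
Qed.

(** * The binary heap and its weights *)

(* Heap with leaves n, ..., 2n-1, the children of j being 2j and 2j+1; f is
   fuel, sufficient when n - j <= f. *)
Fixpoint leaves (n f j : nat) : nat :=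
  if f is f'.+1 then
    if n <= j then 1 else leaves n f' j.*2 + leaves n f' j.*2.+1
  else 1.

Definition weight (n j : nat) : nat := leaves n (n - j) j.

Lemma leaves_fuel n f f' j : 0 < j -> n - j <= f -> n - j <= f' ->
  leaves n f j = leaves n f' j.
Proof.
elim: f f' j => [|f IH] [|f'] j j0 lef lef' //=; try by rewrite ifT //; lia.
case: leqP => // lt; congr (_ + _); apply: IH; lia.
Qed.

Lemma weight_leaf n j : n <= j -> weight n j = 1.
Proof. by rewrite /weight -subn_eq0 => /eqP->. Qed.

Lemma weight_node n j : 0 < j < n ->
  weight n j = weight n j.*2 + weight n j.*2.+1.
Proof.
move=> /andP[j0 jn]; rewrite /weight -(subnSK jn) /= leqNgt jn /=.
by congr (_ + _); apply: leaves_fuel; lia.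
Qed.

(** Induction from the leaves up: the children have indices at least [2j], so by induction each
    child's weight times [j] is at most [n]. *)
Lemma weight_bound n j : 0 < j < n.*2 -> weight n j * j <= n.*2.
Proof.
elim: {j}(n - j) {-2}j (leqnn (n - j)) => [|f IH] j lef j0.
  by rewrite weight_leaf; lia.
case: (leqP n j) => [le|lt]; first by rewrite weight_leaf; lia.
rewrite weight_node; last by lia.
have := IH j.*2 ltac:(lia) ltac:(lia).
have := IH j.*2.+1 ltac:(lia) ltac:(lia).
by nia.
Qed.

(* The name of [spare n j] is shifted by 2n to avoid the names of the nodes. *)
Definition node (n j : nat) : object := (j, (n.+1 + weight n j).*2).
Definition spare (n j : nat) : object := (n.*2 + j, (n.+1).*2).

Lemma excess_node n j : excess n (node n j) = weight n j.
Proof. by rewrite /excess /mu /=; lia. Qed.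

Lemma excess_spare n j : excess n (spare n j) = 0.
Proof. by rewrite /excess /mu /=; lia. Qed.

(** * The update sequence *)

Lemma live_rcons s u : live (rcons s u) = step (live s) u.
Proof. by rewrite /live foldl_rcons. Qed.

(** A form over the naturals, free of [eps], of the conditions on update sequences. Excesses are at
    most [2n] by [weight_bound], whence the size ratio 3. *)
Record admissible (n : nat) (s : seq update) : Prop := Admissible {
  admissible_seq : update_sequence s;
  admissible_load : forall h r, s = h ++ r ->
    \sum_(x <- live h) mu x <= (n * n.+2).*2;
  admissible_size : forall x, x \in map updated s ->
    (n.+1).*2 <= mu x <= 3 * (n.+1).*2 }.

Lemma admissible_nil n : admissible n [::].
Proof.
split=> [[|? ?] //|[|? ?] // [|? ?] // _|//].
by rewrite /live /= big_seq_fset0.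
Qed.

Lemma admissible_rcons n s u : admissible n s -> legal s u ->
  \sum_(x <- live (rcons s u)) mu x <= (n * n.+2).*2 ->
  (n.+1).*2 <= mu (updated u) <= 3 * (n.+1).*2 ->
  admissible n (rcons s u).
Proof.
move=> [sq ld sz] lg lu su; split.
- move=> h v r; case/lastP: r => [|r z].
    by rewrite cats1 => /rcons_inj[<- <-].
  rewrite -rcons_cons -rcons_cat => /rcons_inj[e _]; exact: sq e.
- move=> h r; case/lastP: r => [|r z]; first by rewrite cats0 => <-.
  rewrite -rcons_cat => /rcons_inj[e _]; exact: ld e.
- by move=> x; rewrite map_rcons mem_rcons inE => /orP[/eqP-> //|/sz].
Qed.

Lemma admissible_prefix n s r : admissible n (s ++ r) -> admissible n s.
Proof.
move=> [sq ld sz]; split.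
- by move=> h u t e; apply: (sq h u (t ++ r)); rewrite e -catA.
- by move=> h t e; apply: (ld h (t ++ r)); rewrite e -catA.
- by move=> x xs; apply: sz; rewrite map_cat mem_cat xs.
Qed.

Lemma node_size n j : 0 < j < n.*2 ->
  (n.+1).*2 <= mu (node n j) <= 3 * (n.+1).*2.
Proof. by move=> hj; have := weight_bound hj; rewrite /mu /=; nia. Qed.

Definition loading (n k : nat) : seq update :=
  [seq Insert (node n j) | j <- iota n k].

(** The new node inherits the excess of both children, and the spare restores the number of objects
    and the total size, so the state is tight again. Deleting first keeps the load within its bound
    throughout. *)
Definition combine (n i : nat) : seq update :=
  [:: Delete (node n i.*2); Delete (node n i.*2.+1);
      Insert (node n i); Insert (spare n i)].

(** Parents are created in the order [n-1], [n-2], ..., so both children are live when their parent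
    is due. *)
Fixpoint merging (n t : nat) : seq update :=
  if t is t'.+1 then merging n t' ++ combine n (n - t) else loading n n.

(** The invariant once the nodes from [i] to [n-1] have been created: [i] nodes and [n - i] spares
    are live. [heap_history] keeps the names of the nodes and spares still to come fresh. *)
Record heap (n i : nat) (s : seq update) : Prop := Heap {
  heap_admissible : admissible n s;
  heap_live : forall y, y \in live s <->
    (exists2 j, i <= j < i.*2 & y = node n j) \/
    (exists2 j, i <= j < n & y = spare n j);
  heap_history : forall y, y \in map updated s ->
    i <= y.1 /\ (y.1 < n.*2 \/ n.*2 + i <= y.1);
  heap_card : #|` live s| = n;
  heap_total : \sum_(x <- live s) mu x = (n * n.+2).*2 }.

Lemma loading_spec n k : k <= n ->
  [/\ admissible n (loading n k),
      forall y, y \in live (loading n k) <-> exists2 j, n <= j < n + k & y =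
        node n j,
      forall y, y \in map updated (loading n k) -> n <= y.1 < n + k,
      #|` live (loading n k)| = k &
      \sum_(x <- live (loading n k)) mu x = (k * n.+2).*2].
Proof.
elim: k => [|k IH] lek.
  split=> //; first exact: admissible_nil.
  - by move=> y; split=> [|[j]]; rewrite ?inE //; lia.
  - exact: big_seq_fset0.
have [ad lv hs cd tot] := IH (ltnW lek).
have e : loading n k.+1 = rcons (loading n k) (Insert (node n (n + k))).
  by rewrite /loading -addn1 iotaD map_cat cats1.
have new : node n (n + k) \notin live (loading n k).
  by apply/negP => /lv[j hj [ej _]]; lia.
have totS : \sum_(x <- live (loading n k.+1)) mu x = (k.+1 * n.+2).*2.
  rewrite e live_rcons /= big_fsetU1 //= tot /mu /= weight_leaf; lia.
split=> //.
- rewrite e; apply: admissible_rcons => //.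
  + by split; rewrite /mu /=; [lia|apply/negP => /hs /=; lia].
  + by rewrite -e totS; nia.
  + by apply: node_size; lia.
- move=> y; rewrite e live_rcons /= !inE; split.
    by move=> /orP[/eqP->|/lv[j hj ->]]; [exists (n + k)|exists j] => //; lia.
  move=> [j hj ->]; case: (eqVneq j (n + k)) => [->|ne]; first by rewrite eqxx.
  by apply/orP; right; apply/lv; exists j => //; lia.
- move=> y; rewrite e map_rcons mem_rcons inE => /orP[/eqP->|/hs]; rewrite /=;
    lia.
- by rewrite e live_rcons /= cardfsU1 new cd; lia.
Qed.

Lemma heap_loading n : heap n n (loading n n).
Proof.
have [ad lv hs cd tot] := loading_spec (leqnn n).
split=> //.
- move=> y; rewrite -addnn; split; first by move/lv; left.
  by move=> [/lv //|[j]]; lia.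
- by move=> y /hs; lia.
Qed.

Lemma heap_combine n i s : 0 < i < n -> heap n i.+1 s ->
  heap n i (s ++ combine n i).
Proof.
move=> hi [ad lv hs cd tot]; set X0 := live s.
have wi := weight_node hi.
pose s1 := rcons s (Delete (node n i.*2)).
pose s2 := rcons s1 (Delete (node n i.*2.+1)).
pose s3 := rcons s2 (Insert (node n i)).
pose s4 := rcons s3 (Insert (spare n i)).
have -> : s ++ combine n i = s4 by rewrite /s4 /s3 /s2 /s1 -!cats1 -!catA.
have n1 : node n i.*2 \in live s by apply/lv; left; exists i.*2 => //; lia.
have n2 : node n i.*2.+1 \in live s1.
  rewrite live_rcons /= !inE; apply/andP; split; first by apply/eqP => -[]; lia.
  by apply/lv; left; exists i.*2.+1 => //; lia.
have lv2 y : y \in live s2 <->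
    (exists2 j, i < j < i.*2 & y = node n j) \/
    (exists2 j, i < j < n & y = spare n j).
  rewrite !live_rcons /= !inE; split.
    move=> /and3P[/eqP n2y /eqP n1y /lv[[j hj e]|]]; last by right.
    left; exists j => //; case: (eqVneq j i.*2) => [ej|]; first by case: n1y;
      rewrite e ej.
    by case: (eqVneq j i.*2.+1) => [ej|]; first (by case: n2y; rewrite e ej);
      lia.
  move=> yj; apply/and3P; split.
  - by apply/eqP; case: yj => -[j hj ->] []; lia.
  - by apply/eqP; case: yj => -[j hj ->] []; lia.
  - by apply/lv; case: yj => -[j hj ->]; [left|right]; exists j => //; lia.
have hs2 y : y \in map updated s2 -> i < y.1 /\ (y.1 < n.*2 \/ n.*2 + i < y.1).
  rewrite !(map_rcons, mem_rcons, inE) => /or3P[/eqP->|/eqP->|/hs]; rewrite /=;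
    lia.
have n3 : node n i \notin live s2.
  by apply/negP => /lv2[[j hj [e _]]|[j hj [e _]]]; lia.
have n4 : spare n i \notin live s3.
  rewrite live_rcons [step _ _]/= in_fset1U negb_or; apply/andP; split.
    by apply/eqP => -[]; lia.
  by apply/negP => /lv2[[j hj [e _]]|[j hj [e]]]; lia.
have t1 : \sum_(x <- live s1) mu x + mu (node n i.*2) = (n * n.+2).*2.
  by rewrite -tot [RHS](big_fsetD1 (node n i.*2)) // live_rcons; apply: addnC.
have t2 : \sum_(x <- live s2) mu x + mu (node n i.*2.+1) =
  \sum_(x <- live s1) mu x.
  by rewrite [RHS](big_fsetD1 (node n i.*2.+1)) // live_rcons; apply: addnC.
have t3 : \sum_(x <- live s3) mu x = mu (node n i) + \sum_(x <- live s2) mu x.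
  by rewrite live_rcons /= big_fsetU1.
have t4 : \sum_(x <- live s4) mu x = mu (spare n i) + \sum_(x <- live s3) mu x.
  by rewrite live_rcons /= big_fsetU1.
have tot4 : \sum_(x <- live s4) mu x = (n * n.+2).*2.
  have muE j : mu (node n j) = (n.+1 + weight n j).*2 by [].
  by move: t1 t2 t3 t4; rewrite !muE (_ : mu (spare n i) = (n.+1).*2) // wi;
    lia.
split=> //.
- have a1 : admissible n s1.
    by apply: admissible_rcons => //; [rewrite -/s1; lia|apply: node_size; lia].
  have a2 : admissible n s2.
    by apply: admissible_rcons => //; [rewrite -/s2; lia|apply: node_size; lia].
  have a3 : admissible n s3.
    apply: admissible_rcons => //; [|rewrite -/s3; lia|apply: node_size; lia].
    by split; [rewrite /mu /=; lia|apply/negP => /hs2 /=; lia].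
  apply: admissible_rcons => //; [|by rewrite -/s4; lia|by rewrite /mu /=; lia].
  split; first by rewrite /mu /=; lia.
  rewrite map_rcons mem_rcons inE negb_or; apply/andP; split.
    by apply/eqP => -[]; lia.
  by apply/negP => /hs2 /=; lia.
- move=> y; rewrite /s4 /s3 live_rcons [step _ _]/= in_fset1U.
  rewrite live_rcons [step _ _]/= in_fset1U; split.
    move=> /or3P[/eqP->|/eqP->|/lv2[[j hj ->]|[j hj ->]]].
    + by right; exists i => //; lia.
    + by left; exists i => //; lia.
    + by left; exists j => //; lia.
    + by right; exists j => //; lia.
  case=> -[j hj ->]; case: (eqVneq j i) => [->|ne]; rewrite ?eqxx ?orbT //;
    apply/or3P; apply: Or33; apply/lv2.
    by left; exists j => //; lia.
  by right; exists j => //; lia.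
- move=> y; rewrite /s4 map_rcons mem_rcons inE /s3 map_rcons mem_rcons inE.
  by move=> /or3P[/eqP->|/eqP->|/hs2]; rewrite /=; lia.
- have := cardfsD1 (node n i.*2) (live s);
    have := cardfsD1 (node n i.*2.+1) (live s1).
  rewrite n1 n2 cd /s4 live_rcons /= cardfsU1 n4 /s3 live_rcons /= cardfsU1 n3.
  by rewrite /s2 live_rcons /= /s1 live_rcons /=; lia.
Qed.

Lemma heap_merging n t : t < n -> heap n (n - t) (merging n t).
Proof.
elim: t => [|t IH] lt; first by rewrite subn0; apply: heap_loading.
have := @heap_combine n (n - t.+1) (merging n t); rewrite subnSK;
  last exact: ltnW.
by apply; [lia|exact: IH (ltnW lt)].
Qed.

Lemma heap_tight n i s : heap n i s -> tight n (live s).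
Proof.
case=> _ lv _ cd tot; split=> // x /lv[[j _ ->]|[j _ ->]].
  by rewrite excess_node.
by rewrite excess_spare addn0.
Qed.

(** Live nodes have index at least [i], so [weight_bound] applies to all of them. *)
Lemma heap_excess n i s x : 0 < i <= n -> heap n i s -> x \in live s ->
  excess n x * i <= n.*2.
Proof.
move=> hi [_ lv _ _ _] /lv[[j hj ->]|[j _ ->]]; last by rewrite excess_spare.
rewrite excess_node; have := @weight_bound n j; nia.
Qed.

(** * Total variation of the profile *)

(** Stated for partial sums to allow induction on [k]; at [k = n] it says that six times the sum is
    [n^3 - n]. *)
Lemma sum_mul_sub n k : k <= n ->
  6 * (\sum_(0 <= i < k) i * (n - i)) + k * k.-1 * (k.*2 - 1) =
    3 * n * k * k.-1.
Proof.
elim: k => [|k IH] lek; first by rewrite big_geq //; lia.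
rewrite big_nat_recr //= mulnDr; have {IH} := IH (ltnW lek).
set S := \sum_(0 <= i < k) _.
have [d nE] : exists d, n = k + d by exists (n - k); lia.
case: k lek S nE => [|k] lek S -> /=; first by lia.
rewrite addKn; set K := k; nia.
Qed.

Lemma leq_adist_sum (F : nat -> nat) k :
  adist (F 0) (F k) <= \sum_(0 <= t < k) adist (F t) (F t.+1).
Proof.
elim: k => [|k IH]; first by rewrite /adist subnn.
rewrite big_nat_recr //=; apply: leq_trans (leq_adist_trans (F k) _ _) _.
by rewrite leq_add2r.
Qed.

Definition kept_stage n (phi : nat -> object -> nat) t : {fset object} :=
  kept (live (merging n t)) (live (merging n t.+1)) (phi t) (phi t.+1).

Lemma merging_variation n (phi : nat -> object -> nat) : 0 < n ->
  (forall t, t < n ->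
     is_allocation (memory n) (live (merging n t)) (phi t)) ->
  n ^ 3 <= n + 6 * n *
    \sum_(0 <= t < n.-1)
       (n - #|` kept_stage n phi t|) ^ 2 * (n.*2 %/ (n - t.+1)).
Proof.
move=> n0 al.
pose P t i := profile n (live (merging n t)) (phi t) i.
have tg t : t < n -> tight n (live (merging n t)).
  by move=> lt; apply: heap_tight (heap_merging lt).
have P0 i : i <= n -> P 0 i = i.
  apply: profile_start (tg 0 n0) (al 0 n0) _ => x.
  have := heap_live (heap_merging n0) x; rewrite subn0 => H /H[[j hj ->]|[j]];
    last by lia.
  by rewrite excess_node weight_leaf //; lia.
have lt1 : n.-1 < n by lia.
have P1 i : P n.-1 i = 0 \/ P n.-1 i = n.
  apply: (@profile_end _ _ _ _ (node n 1)) (tg _ lt1) _ => x.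
  have := heap_live (heap_merging lt1) x; rewrite (_ : n - n.-1 = 1);
    last by lia.
  move=> H /H[[j hj ->]|[j hj ->]]; last by rewrite excess_spare.
  by rewrite (_ : j = 1) ?eqxx //; lia.
(* At stages [t] and [t+1] all live nodes have index at least [n - t.+1], so [profile_change]
   applies with [w] the integer part of [2n / (n - t.+1)]. *)
have step t : t < n.-1 -> \sum_(0 <= i < n) adist (P t i) (P t.+1 i) <=
    (n - #|` kept_stage n phi t|) ^ 2 * (n.*2 %/ (n - t.+1)).
  move=> lt; have [lt0 ltS] : t < n /\ t.+1 < n by lia.
  apply: profile_change; [exact: tg|exact: tg|exact: al|exact: al|..] => x xX;
    rewrite leq_divRL; try by lia.
    have := @heap_excess n (n - t) (merging n t) x ltac:(lia) (heap_merging lt0)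
      xX.
    by nia.
  by apply: (@heap_excess n (n - t.+1) (merging n t.+1) x) xX;
    [lia|exact: heap_merging].
(* The profile at [i] goes from [i] to 0 or [n], a change of at least [min(i, n-i)], and [n] times
   this is at least [i * (n - i)]. *)
have sq : \sum_(0 <= i < n) i * (n - i) <= n * \sum_(0 <=
  i < n) adist (P 0 i) (P n.-1 i).
  rewrite big_distrr /= big_nat_cond [leqRHS]big_nat_cond.
  apply: leq_sum => i /andP[/andP[_ lt] _]; rewrite P0; last exact: ltnW.
  by rewrite /adist; case: (P1 i) => ->; nia.
(* Triangle inequality over the stages, then exchange of the two sums. *)
have le : \sum_(0 <= i < n) adist (P 0 i) (P n.-1 i) <=
    \sum_(0 <= t < n.-1)
       (n - #|` kept_stage n phi t|) ^ 2 * (n.*2 %/ (n - t.+1)).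
  apply: (@leq_trans (\sum_(0 <= i < n) \sum_(0 <=
    t < n.-1) adist (P t i) (P t.+1 i))).
    by apply: leq_sum => i _; apply: (leq_adist_sum (fun t => P t i)).
  rewrite exchange_big /= big_nat_cond [leqRHS]big_nat_cond.
  by apply: leq_sum => t /andP[/andP[_ lt] _]; apply: step.
have := sum_mul_sub (leqnn n).
move: sq le; set S := \sum_(0 <= i < n) _; set D := \sum_(0 <= i < n) _.
set B := \sum_(0 <= t < n.-1) _ => sq le.
clearbody S D B; case: n n0 sq le {al P tg P0 lt1 P1 step} => // n _ sq le.
have : n.+1 * D <= n.+1 * B by rewrite leq_mul2l le orbT.
rewrite /= => leB e; have {sq leB}: S <= n.+1 * B by lia.
by rewrite !expnS expn0 in e *; nia.
Qed.

(** * From kept objects to overheads *)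

Definition moved (T : Type) (A : strategy T) (M : nat) (h : seq update)
    (u : update) (w : T) : seq object :=
  [seq y <- (live h `&` live (rcons h u))%fset
     | A M h w y != A M (rcons h u) w y].

Definition merge_prefix (n t r : nat) : seq update :=
  merging n t ++ take r (combine n (n - t.+1)).

(** The default of [nth] is never reached: [combine] has four updates and [r] is below 4. *)
Definition merge_update (n t r : nat) : update :=
  nth (Delete (0, 0)) (combine n (n - t.+1)) r.

Lemma merge_prefixS n t r : r < 4 ->
  merge_prefix n t r.+1 = rcons (merge_prefix n t r) (merge_update n t r).
Proof.
by move=> lt; rewrite /merge_prefix (take_nth (Delete (0, 0))) ?rcons_cat.
Qed.

Lemma merge_prefix_split n t r : r < 4 ->
  merging n t.+1 = merge_prefix n t r ++ merge_update n t r ::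
    drop r.+1 (combine n (n - t.+1)).
Proof.
by move=> lt; rewrite -cat_rcons -merge_prefixS //
  /merge_prefix -catA cat_take_drop.
Qed.

Lemma merging_split n t k : t <= k -> exists r, merging n k = merging n t ++ r.
Proof.
elim: k => [|k IH]; first by rewrite leqn0 => /eqP->; exists [::];
  rewrite cats0.
rewrite leq_eqVlt => /orP[/eqP->|]; first by exists [::]; rewrite cats0.
by rewrite ltnS => /IH[r e]; exists (r ++ combine n (n - k.+1));
  rewrite /= e catA.
Qed.

(** An object that is neither one of the two deleted children nor moved by any of the four updates
    stays live and keeps its address from one stage to the next. *)
Lemma kept_merge (T : Type) (A : strategy T) M n t w :
  #|` live (merging n t)| = n ->
  n - #|` kept_stage n (fun t => A M (merging n t) w) t| <=
  2 + \sum_(r < 4) size (moved A M (merge_prefix n t r) (merge_update n t r) w).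
Proof.
move=> cd; set X := live (merging n t); set U := kept_stage _ _ _.
set i := n - t.+1.
pose h r := merge_prefix n t r;
  pose mv r := moved A M (h r) (merge_update n t r) w.
have h0 : h 0 = merging n t by rewrite /h /merge_prefix take0 cats0.
have h4 : h 4 = merging n t.+1 by [].
rewrite leq_subLR -[leqLHS]cd !big_ord_recl big_ord0 addn0 -/(mv 0) -/(mv 1)
  -/(mv 2) -/(mv 3).
have -> : 2 = size [:: node n i.*2; node n i.*2.+1] by [].
rewrite -[#|` U|]/(size U) -!size_cat; apply: uniq_leq_size;
  first exact: fset_uniq.
move=> y yX; rewrite !mem_cat !inE; apply/negPn/negP.
rewrite !negb_or => /and5P[yU /andP[n1 n2] m0 m1 /andP[m2 m3]].
have l0 : y \in live (h 0) by rewrite h0.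
have lS r : r < 4 -> live (h r.+1) = step (live (h r)) (merge_update n t r).
  by move=> lt; rewrite /h merge_prefixS // live_rcons.
have l1 : y \in live (h 1) by rewrite lS //= in_fsetD1 n1.
have l2 : y \in live (h 2) by rewrite lS //= in_fsetD1 n2.
have l3 : y \in live (h 3) by rewrite lS //= in_fset1U l2 orbT.
have l4 : y \in live (h 4) by rewrite lS //= in_fset1U l3 orbT.
have stay r : r < 4 -> y \in live (h r) -> y \in live (h r.+1) ->
  y \notin mv r ->
    A M (h r) w y = A M (h r.+1) w y.
  move=> lt lr lr1; rewrite /mv /moved mem_filter in_fsetI -merge_prefixS //.
  by rewrite -/(h r) -/(h r.+1) lr lr1 /= andbT negbK => /eqP.
have eA : A M (h 0) w y = A M (h 4) w y.
  by rewrite stay // stay // stay // stay.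
rewrite h0 in eA; move/negP: yU; apply.
by apply/and3P; split; [exact: yX|exact: l4|exact/eqP].
Qed.

Lemma live_updated h x : x \in live h -> x \in map updated h.
Proof.
elim/last_ind: h => [//|h u IH]; rewrite live_rcons map_rcons mem_rcons inE.
case: u => z /=; first by rewrite in_fset1U => /orP[->//|/IH ->]; rewrite orbT.
by rewrite in_fsetD1 => /andP[_ /IH ->]; rewrite orbT.
Qed.

Local Open Scope ring_scope.

(** Any two sizes differ by a factor of at most 3, so each moved object adds at least 1/3 to the
    overhead. *)
Lemma overhead_moved (R : realType) (T : Type) (A : strategy T) M n h u (w : T)
  :
  admissible n (rcons h u) ->
  1 + (size (moved A M h u w))%:R / 3 <= overhead R A M h u w.
Proof.
move=> ad; rewrite /overhead lerD2l -natr_sum.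
have := admissible_size ad (x := updated u).
rewrite map_rcons mem_rcons inE eqxx => /(_ isT) /andP[lo hi].
have mu0 : 0 < (mu (updated u))%:R :> R by rewrite ltr0n; lia.
rewrite [leRHS]mulrC ler_pdivlMr // mulrAC ler_pdivrMr // -!natrM ler_nat.
apply: (@leq_trans (size (moved A M h u w) * (3 * (n.+1).*2))%N).
  by rewrite leq_mul2l hi orbT.
rewrite mulnCA mulnC leq_mul2r /=.
rewrite -big_filter -/(moved A M h u w) -sum1_size big_distrl /=.
rewrite big_seq [X in (_ <= X)%N]big_seq; apply: leq_sum => y.
rewrite mem_filter in_fsetI mul1n => /and3P[_ _ /live_updated yu].
by have /andP[] := admissible_size ad yu.
Qed.

(** * Expectations and measurability *)

Lemma expectation_weighted_sum (R : realType) (d : measure_display)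
    (T : measurableType d) (P : probability T R) (I : finType)
    (f : I -> T -> R) (c : I -> R) (C g : R) :
  0 <= C -> (forall i, measurable_fun setT (f i)) -> (forall i w, 0 <= f i w) ->
  (forall i, 0 <= c i) -> (forall w, C <= \sum_i c i * f i w) ->
  (forall i, ('E_P[f i] <= g%:E)%E) -> C <= (\sum_i c i) * g.
Proof.
move=> C0 mf f0 c0 leC leg; rewrite -lee_fin.
have -> : C%:E = (\int[P]_w (cst C%:E w))%E.
  by rewrite integral_cst //= probability_setT mule1.
apply: (@le_trans _ _ (\int[P]_w (\sum_i (c i)%:E * (f i w)%:E))%E).
  apply: ge0_le_integral => //.
  - apply: emeasurable_sum => i; apply: measurable_funeM.
    exact/measurable_EFinP.
  - move=> w _; rewrite /cst /=; under eq_bigr do rewrite -EFinM.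
    by rewrite sumEFin lee_fin.
rewrite ge0_integral_sum //; first last.
  - by move=> i w _; rewrite mule_ge0 // lee_fin.
  - by move=> i; apply: measurable_funeM; exact/measurable_EFinP.
rewrite mulr_suml -sumEFin; apply: lee_sum => i _.
rewrite ge0_integralZl_EFin //; first last.
  - exact/measurable_EFinP.
  - by move=> w _; rewrite lee_fin.
rewrite EFinM; apply: lee_wpmul2l; first by rewrite lee_fin.
by have := leg i; rewrite unlock.
Qed.

(** The overhead is a finite combination of indicators of the events that [y] moves. The complement
    of such an event is the union over addresses [k] of the events that [y] sits at [k] both before
    and after, a countable union of measurable sets. *)
Lemma measurable_overhead (R : realType) (lambda : R) (d : measure_display)
    (T : measurableType d) (A : strategy T) M h u :
  is_allocator lambda A -> (0 < M)%N -> update_sequence (rcons h u) ->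
  has_load_factor M lambda (rcons h u) ->
  measurable_fun setT (overhead R A M h u).
Proof.
move=> alA M0 us lf.
have us' : update_sequence h.
  by move=> h1 v r e; apply: (us h1 v (rcons r u));
    rewrite e -rcons_cons -rcons_cat.
have lf' : has_load_factor M lambda h.
  by move=> h1 r e; apply: (lf h1 (rcons r u)); rewrite e -rcons_cat.
have m1 := (alA M h M0 us' lf').2; have m2 := (alA M (rcons h u) M0 us lf).2.
set L := (live h `&` live (rcons h u))%fset.
pose E y := [set w | y \in L /\ A M h w y <> A M (rcons h u) w y]%classic.
have mE y : measurable (E y).
  case: (boolP (y \in L)) => [yL|yL]; last first.
    rewrite (_ : E y = set0) //; apply/seteqP; split=> // w [] yL'.
    by rewrite yL' in yL.
  have -> : E y = (~` \bigcup_k ([set w | A M h w y = k] `&`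
      [set w | A M (rcons h u) w y = k]))%classic.
    apply/seteqP; split=> w.
      by move=> [_ ne] [k _ [/= e e']]; apply: ne; rewrite e e'.
    by move=> nk; split=> // e; apply: nk; exists (A M h w y).
  apply: measurableC; apply: bigcup_measurable => k _; apply: measurableI.
    by apply: m1; move: yL; rewrite in_fsetI => /andP[].
  by apply: m2; move: yL; rewrite in_fsetI => /andP[].
have -> : overhead R A M h u =
    (fun w => 1 + (mu (updated u))%:R^-1 * \sum_(y <- L) (mu y)%:R * \1_(E y)
      w).
  apply/funext => w; rewrite /overhead; congr (1 + _ * _).
  rewrite big_mkcond /=; apply: eq_big_seq => y yL; rewrite indicE.
  case: ifPn => [/eqP ne|/negPn/eqP e].
    by rewrite mem_set ?mulr1.
  by rewrite memNset ?mulr0 // => -[].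
apply: measurable_funD; first exact: measurable_cst.
apply: measurable_funM; first exact: measurable_cst.
apply: measurable_sum => y; apply: measurable_funM; first exact: measurable_cst.
exact: measurable_indic.
Qed.

(** The one free slot is all the slack that the load factor demands, because [eps] times the memory
    is at most 1. *)
Lemma admissible_load_factor (R : realType) (eps : R) n s :
  eps * (memory n)%:R <= 1 -> admissible n s ->
  has_load_factor (memory n) (1 - eps) s.
Proof.
move=> le1 ad h r e; have := admissible_load ad e; rewrite -natr_sum => le.
rewrite mulrBl mul1r lerBrDr; apply: (@le_trans _ _ ((n * n.+2).*2%:R + 1)).
  by apply: lerD; rewrite // ler_nat.
by rewrite /memory -natr1.
Qed.

Lemma merge_prefix_admissible n t r : (t < n.-1)%N -> (r < 4)%N ->
  admissible n (rcons (merge_prefix n t r) (merge_update n t r)).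
Proof.
move=> lt ltr; have hp : heap n (n - t.+1) (merging n t.+1).
  by apply: heap_merging; lia.
apply: (@admissible_prefix n _ (drop r.+1 (combine n (n - t.+1)))).
by rewrite cat_rcons -merge_prefix_split //; exact: heap_admissible hp.
Qed.

Lemma sqr_sum4_le (R : realType) (f : 'I_4 -> R) :
  (\sum_r f r) ^+ 2 <= 4 * \sum_r f r ^+ 2.
Proof.
rewrite !big_ord_recl !big_ord0 !addr0.
set a := f _; set b := f _; set c := f _; set d := f _.
rewrite -subr_ge0.
have -> : 4 * (a ^+ 2 + (b ^+ 2 + (c ^+ 2 + d ^+ 2))) - (a + (b + (c +
  d))) ^+ 2 =
  (a - b) ^+ 2 + (a - c) ^+ 2 + (a - d) ^+ 2 + (b - c) ^+ 2 + (b - d) ^+ 2 +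
  (c - d) ^+ 2 by ring.
by rewrite !addr_ge0 ?sqr_ge0.
Qed.

Lemma merging_overhead (R : realType) (T : Type) (A : strategy T)
    n (w : T) : (0 < n)%N ->
  (forall t, (t < n)%N ->
     is_allocation (memory n) (live (merging n t)) (A (memory n) (merging n t)
       w)) ->
  n%:R ^+ 3 - n%:R <=
  \sum_(p : 'I_n.-1 * 'I_4) 432 * n%:R ^+ 2 / (n - p.1.+1)%:R *
    overhead R A (memory n) (merge_prefix n p.1 p.2) (merge_update n p.1 p.2) w
      ^+ 2.
Proof.
move=> n0 al; have := merging_variation n0 al; rewrite big_mkord.
set B := (\sum_(t < n.-1) _)%N => leB.
pose o t r := overhead R A (memory n) (merge_prefix n t r) (merge_update n t r)
  w.
rewrite -(pair_bigA _ (fun (t : 'I_n.-1) (r : 'I_4) =>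
  432 * n%:R ^+ 2 / (n - t.+1)%:R * o t r ^+ 2)) /=.
have leB' : n%:R ^+ 3 - n%:R <= 6 * n%:R * B%:R :> R.
  by rewrite lerBlDl -natrX -!natrM -natrD ler_nat.
apply: (le_trans leB'); rewrite /B natr_sum mulr_sumr; apply: ler_sum => t _.
have ltt := ltn_ord t; have i0 : 0 < (n - t.+1)%:R :> R by rewrite ltr0n; lia.
rewrite -mulr_sumr natrM; set q := (n - _)%N.
(* The factor 3 cancels the 1/3 of [overhead_moved], and the four summands 1 then cover the 2 of
   [kept_merge]. *)
have qle : q%:R <= 3 * \sum_(r < 4) o t r.
  have hp : heap n (n - t) (merging n t) by apply: heap_merging; lia.
  have := @kept_merge T A (memory n) n t w (heap_card hp).
  rewrite -/q -(ler_nat R) natrD natr_sum => /le_trans; apply.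
  have := fun r : 'I_4 => @overhead_moved R T A (memory n) n _ _ w 
    (merge_prefix_admissible ltt (ltn_ord r)).
  rewrite -/o => leo.
  have : \sum_(r < 4) (1 +
    (size (moved A (memory n) (merge_prefix n t r) (merge_update n t r) w))%:R /
    3)
     <= \sum_(r < 4) o t r by apply: ler_sum => r _; exact: leo.
  rewrite big_split /= -mulr_suml sumr_const card_ord.
  by set S := \sum_(r < 4) _%:R; set S' := \sum_(r < 4) _; lra.
have q2 : (q ^ 2)%:R <= 36 * \sum_(r < 4) o t r ^+ 2.
  rewrite natrX; have : q%:R ^+ 2 <= (3 * \sum_(r < 4) o t r) ^+ 2.
    by rewrite lerXn2r ?nnegrE // (le_trans _ qle).
  by have := sqr_sum4_le (fun r : 'I_4 => o t r); rewrite exprMn; lra.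
have dv : (n.*2 %/ (n - t.+1))%:R <= 2 * n%:R / (n - t.+1)%:R :> R.
  by rewrite ler_pdivlMr // -!natrM ler_nat mul2n; exact: leq_divM.
have := ler_pM (ler0n _ _) (ler0n _ _) q2 dv; set S := \sum_(r < 4) _ => le.
(* 432 is 6 from [merging_variation], times 36 from [q2] (the square of 3, times 4 by
   Cauchy-Schwarz), times 2 from [dv]. *)
have -> : 432 * n%:R ^+ 2 / (n - t.+1)%:R * S =
    6 * n%:R * (36 * S * (2 * n%:R / (n - t.+1)%:R)).
  by field; rewrite lt0r_neq0.
by apply: ler_wpM2l => //; rewrite mulr_ge0.
Qed.

(** The first [m] terms are at most 1 and the later ones at most [1/m]. This avoids logarithms; [m]
    will be the cube root of [n]. *)
Lemma harmonic_le (R : realType) k m : (0 < m)%N ->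
  \sum_(i < k) (i.+1%:R)^-1 <= m%:R + k%:R / m%:R :> R.
Proof.
move=> m0; have m0' : 0 < m%:R :> R by rewrite ltr0n.
apply: (@le_trans _ _ (\sum_(i < k) ((i < m)%:R + (m%:R)^-1))).
  apply: ler_sum => i _; case: ltnP => [lt|le].
    rewrite -[leLHS]addr0; apply: lerD; last by rewrite invr_ge0 ltW.
    by rewrite invf_le1 ?ler1n // ltr0n.
  by rewrite add0r lef_pV2 ?posrE ?ltr0n // ler_nat ltnW // ltnS.
rewrite big_split /= sumr_const card_ord mulr_natl lerD2r -natr_sum ler_nat.
elim: k => [|k IH]; first by rewrite big_ord0.
have : (\sum_(i < k.+1) (i < m) <= k.+1)%N.
  rewrite -[leqRHS]card_ord -sum1_card; apply: leq_sum => i _; exact: leq_b1.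
rewrite big_ord_recr /=; case: (ltnP k m) => lt; first by lia.
by rewrite addn0.
Qed.

Lemma harmonic_rev (R : realType) n :
  \sum_(t < n.-1) ((n - t.+1)%:R)^-1 = \sum_(i < n.-1) (i.+1%:R)^-1 :> R.
Proof.
rewrite (reindex_inj rev_ord_inj); apply: eq_bigr => i _.
by congr (_%:R^-1); rewrite /=; have := ltn_ord i; lia.
Qed.

Lemma merging_squared_overhead (R : realType) (eps : R) (d : measure_display)
    (T : measurableType d) (P : probability T R) (A : strategy T) (g : R) n :
  (0 < n)%N -> is_allocator (1 - eps) A -> eps * (memory n)%:R <= 1 ->
  (forall h u r, merging n n.-1 = h ++ u :: r ->
     ('E_P[fun w => (overhead R A (memory n) h u w ^+ 2)%R] <= g%:E)%E) ->
  n%:R ^+ 3 - n%:R <=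
    12 ^+ 3 * n%:R ^+ 2 * (\sum_(i < n.-1) (i.+1%:R)^-1) * g.
Proof.
move=> n0 alA le1 leg.
have heapT t : (t < n)%N -> heap n (n - t) (merging n t) := @heap_merging n t.
have al w t : (t < n)%N -> is_allocation (memory n) (live (merging n t))
    (A (memory n) (merging n t) w).
  move=> lt; have ad := heap_admissible (heapT t lt).
  by have [/(_ w)] := alA (memory n) (merging n t) isT (admissible_seq ad)
    (admissible_load_factor le1 ad).
(* [12^3] is 4 times 432, for the four updates of each merge. *)
have -> : 12 ^+ 3 * n%:R ^+ 2 * (\sum_(i < n.-1) (i.+1%:R)^-1) =
    \sum_(p : 'I_n.-1 * 'I_4) 432 * n%:R ^+ 2 / (n - p.1.+1)%:R :> R.
  rewrite -(pair_bigA _ (fun (t : 'I_n.-1) (r : 'I_4) =>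
    432 * n%:R ^+ 2 / (n - t.+1)%:R)) /=.
  rewrite -harmonic_rev mulr_sumr; apply: eq_bigr => t _.
  by rewrite sumr_const card_ord -mulr_natl; ring.
apply: (@expectation_weighted_sum _ _ _ P _ (fun (p : 'I_n.-1 * 'I_4) w =>
  overhead R A (memory n) (merge_prefix n p.1 p.2) (merge_update n p.1 p.2) w ^+
    2)).
- by rewrite subr_ge0 -natrX ler_nat; apply: (@leq_pexp2l n 1 3).
- move=> [t r]; apply: measurable_funX.
  have ad := merge_prefix_admissible (ltn_ord t) (ltn_ord r).
  apply: (@measurable_overhead R (1 - eps) d T A (memory n)) => //.
    exact: admissible_seq ad.
  exact: admissible_load_factor le1 ad.
- by move=> p w; apply: sqr_ge0.
- by move=> p; rewrite divr_ge0 ?mulr_ge0 ?ler0n ?sqr_ge0.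
- by move=> w; apply: merging_overhead => // t; apply: al.
- move=> [t r]; have [s e] := merging_split n (ltn_ord t : (t.+1 <= n.-1)%N).
  apply: (leg _ _ (drop r.+1 (combine n (n - t.+1)) ++ s)).
  by rewrite e (merge_prefix_split n t (ltn_ord r)) -catA.
Qed.

(** * Choice of parameters *)

Lemma natr_memory (R : realType) n :
  (memory n)%:R = 2 * n%:R ^+ 2 + 4 * n%:R + 1 :> R.
Proof.
by rewrite -natrX -!natrM -!natrD natr1; congr (_%:R); rewrite /memory; lia.
Qed.

(** Here [y] stands for [eps^(3/7)]. The memory is about [2n^2] and [y] lies between [1/(8n)] and
    [1/n], so [y] times the memory matches the sizes, of order [n], up to the constants [1/2] and
    24. *)
Lemma merging_sizes (R : realType) (y : R) n s : (0 < n)%N -> 0 < y ->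
  n%:R * y <= 1 -> 1 <= 8 * n%:R * y -> admissible n s ->
  sizes_within (2^-1 * y * (memory n)%:R) (24 * y * (memory n)%:R) s.
Proof.
move=> n0 y0 ny1 ny8 ad x /(admissible_size ad) /andP[lo hi].
have lo' : 2 * n%:R + 2 <= (mu x)%:R :> R.
  by rewrite -natrM -natrD ler_nat; clear -lo; lia.
have hi' : (mu x)%:R <= 6 * n%:R + 6 :> R.
  by rewrite -natrM -natrD ler_nat; clear -hi; lia.
have n1 : 1 <= n%:R :> R by rewrite ler1n.
clear -y0 ny1 ny8 lo' hi' n1.
rewrite natr_memory; apply/andP; split; nra.
Qed.

Theorem theorem1p4 (R : realType) :
  exists c c1 c2 eps0 : R,
    (0 < c /\ 0 < c1 /\ 0 < c2 /\ 0 < eps0) /\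
    forall eps : R, 0 < eps < eps0 ->
    forall (d : measure_display) (T : measurableType d) (P : probability T R)
           (A : strategy T) (g : R -> R),
      is_allocator (1 - eps) A ->
      (forall (M : nat) (s : seq update),
         (0 < M)%N ->
         update_sequence s ->
         has_load_factor M (1 - eps) s ->
         sizes_within (c1 * eps `^ (3 / 7) * M%:R)
                      (c2 * eps `^ (3 / 7) * M%:R) s ->
         forall h u r, s = h ++ u :: r ->
           ('E_P[fun w => (overhead R A M h u w ^+ 2)%R] <= (g eps)%:E)%E) ->
      c * eps `^ (- (1 / 7)) <= g eps.
Proof.
(* The bound on [eps] gives [z < 1/10] for [z = eps^(1/7)]. The constant [24^3] is [2 * 4 * 12^3],
   collected in the last steps; [1/2] and 24 come from [merging_sizes]. *)
exists (24^-1 ^+ 3), (2^-1), 24, (10^-1 ^+ 7).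
split; first by rewrite !exprn_gt0 ?invr_gt0 ?ltr0n.
move=> eps /andP[eps0 epslt] d T P A g alA leg.
set z := eps `^ (1 / 7).
have z0 : 0 < z by apply: powR_gt0.
have zX k : eps `^ (k%:R / 7) = z ^+ k.
  by rewrite -powR_mulrn ?ltW // -powRrM; congr (_ `^ _); field.
have z7 : eps = z ^+ 7 by rewrite -zX divff ?powRr1 // ltW.
have zlt : z < 10^-1.
  by rewrite -(@ltr_pXn2r _ 7) ?nnegrE ?ltW // -?z7 // invr_gt0.
rewrite powRN -/z; rewrite (zX 3%N) in leg.
have zV0 : 0 <= z^-1 by rewrite invr_ge0 ltW.
(* With [m] the integer part of [1/z] and [n = m^3], [n] is of order [eps^(-3/7)] and has an exact
   cube root for [harmonic_le]. *)
have [m /andP[mle ltm]] : exists m, m%:R <= z^-1 < m.+1%:R.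
  by exists (Num.truncn z^-1); apply: truncn_itv.
have m10 : (10 <= m)%N.
  rewrite -ltnS -(ltr_nat R); apply: le_lt_trans ltm.
  by rewrite -[leLHS]invrK lef_pV2 ?posrE ?invr_gt0 // ltW.
have m1 : (0 < m)%N by apply: leq_trans m10.
have m2 : (m.+1 <= 2 * m)%N by rewrite mul2n -addnn -addn1 leq_add2l.
have [n nE] : exists n, n = (m ^ 3)%N by exists (m ^ 3)%N.
have nm : n%:R = m%:R ^+ 3 :> R by rewrite nE natrX.
have n2 : (2 <= n)%N by rewrite nE (leq_trans _ (@leq_pexp2l m 1 3 m1 isT)) //
  (leq_trans _ m10).
have n0 : (0 < n)%N := ltnW n2.
clear nE.
have mz : m%:R * z <= 1 by rewrite -ler_pdivlMr // mul1r.
have zm : 1 <= 2 * m%:R * z.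
  rewrite -ler_pdivrMr // mul1r; apply: (le_trans (ltW ltm)).
  by rewrite -natrM ler_nat.
have nz1 : n%:R * z ^+ 3 <= 1.
  by rewrite nm -exprMn exprn_ile1 // mulr_ge0 // ltW.
have nz8 : 1 <= 8 * n%:R * z ^+ 3.
  have -> : 8 * n%:R * z ^+ 3 = (2 * m%:R * z) ^+ 3 by rewrite nm; ring.
  exact: exprn_ege1.
have Mle : (memory n)%:R <= 7 * n%:R ^+ 2 :> R.
  have : 1 <= n%:R :> R by rewrite ler1n.
  by rewrite natr_memory; nra.
have epsM : eps * (memory n)%:R <= 1.
  (* As [eps = z^7], one factor [z] is left over beside [(n * z^3)^2 <= 1], and it absorbs the 7. *)
  apply: (@le_trans _ _ (7 * (z * (n%:R * z ^+ 3) ^+ 2))).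
    have -> : 7 * (z * (n%:R * z ^+ 3) ^+ 2) =
      eps * (7 * n%:R ^+ 2) by rewrite z7; ring.
    by apply: ler_wpM2l => //; exact: ltW.
  have : (n%:R * z ^+ 3) ^+ 2 <= 1.
    by rewrite exprn_ile1 // mulr_ge0 // exprn_ge0 // ltW.
  move=> /(ler_wpM2l (ltW z0)); rewrite mulr1; lra.
have ad : admissible n (merging n n.-1).
  by apply: heap_admissible (heap_merging _); rewrite ltn_predL.
have sz := merging_sizes n0 (exprn_gt0 3 z0) nz1 nz8 ad.
have := merging_squared_overhead n0 alA epsM
  (leg (memory n) _ isT (admissible_seq ad) (admissible_load_factor epsM ad)
    sz).
set H := \sum_(i < _) _ => leH.
have H0 : 0 <= H by apply: sumr_ge0 => i _; rewrite invr_ge0.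
(* Cutting the harmonic sum at [m] gives [m + n/m], with [n/m = m^2]. *)
have Hle : H <= 2 * m%:R ^+ 2.
  apply: (le_trans (harmonic_le R n.-1 m1)).
  have : n.-1%:R / m%:R <= m%:R ^+ 2 :> R.
    by rewrite ler_pdivrMr ?ltr0n // -exprSr -nm ler_nat leq_pred.
  have : m%:R <= m%:R ^+ 2 :> R.
    by rewrite -natrX ler_nat; apply: (@leq_pexp2l m 1 2).
  lra.
have m0 : 0 < m%:R :> R by rewrite ltr0n.
have n0' : 0 < n%:R :> R by rewrite ltr0n.
(* Hence [n^3 - n] is at least half of [n^3]. *)
have nn : 2 * n%:R <= n%:R ^+ 3 :> R.
  rewrite -natrX -natrM ler_nat expnSr leq_mul2r; apply/orP; right.
  exact: leq_trans n2 (@leq_pexp2l n 1 2 n0 isT).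
have g0 : 0 < g eps.
  rewrite ltNge; apply/negP => g0.
  have : 12 ^+ 3 * n%:R ^+ 2 * H * g eps <= 0.
    by rewrite mulr_ge0_le0 // !mulr_ge0 ?exprn_ge0 ?ler0n.
  lra.
have le1 : 12 ^+ 3 * n%:R ^+ 2 * H * g eps <=
    12 ^+ 3 * n%:R ^+ 2 * (2 * m%:R ^+ 2) * g eps.
  by rewrite ler_pM2r // ler_wpM2l // mulr_ge0 ?exprn_ge0 ?ler0n.
have le2 : n%:R ^+ 3 <= 4 * 12 ^+ 3 * n%:R ^+ 2 * m%:R ^+ 2 * g eps by lra.
have le3 : m%:R <= 4 * 12 ^+ 3 * g eps.
  rewrite -(@ler_pM2l _ (n%:R ^+ 2 * m%:R ^+ 2)) ?mulr_gt0 ?exprn_gt0 //.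
  have -> : n%:R ^+ 2 * m%:R ^+ 2 * m%:R = n%:R ^+ 3 :> R by rewrite nm; ring.
  by apply: (le_trans le2); rewrite le_eqVlt; apply/orP; left; apply/eqP; ring.
have le4 : z^-1 <= 2 * m%:R.
  by apply: (le_trans (ltW ltm)); rewrite -natrM ler_nat.
rewrite exprVn ler_pdivrMl ?exprn_gt0 //; apply: (le_trans le4).
have -> : 24 ^+ 3 * g eps = 2 * (4 * 12 ^+ 3 * g eps) by ring.
by rewrite ler_pM2l.
Qed.
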